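(* Let $D=G_{\mathcal{O}}$ be the oriented graph associated to an orientation $\mathcal{O}$ of the edges of a finite simple graph $G$. The primitive binomials of $P_D$ are exactly the binomials $t_C$ of $P_D$ associated to cycles $C$ of $D$.
   Context: Let $k$ be a field. $D$ has vertices $x_1,\dots,x_n$ and oriented edges $t_1,\dots,t_q$. The toric ideal $P_D$ is the kernel of the $k$-algebra map $\varphi:k[t_1,\dots,t_q]\to k[x_1^{\pm1},\dots,x_n^{\pm1}]$ sending an edge $t_\ell=(x_i,x_j)$ (from $x_i$ to $x_j$) to $x_jx_i^{-1}$. A cycle of $D$ means a cycle of the underlying graph $G$. Given a cycle $C=(x_{j_1},\dots,x_{j_m},x_{j_{m+1}}=x_{j_1})$, let $C_+$ be the set of edges of $C$ of the form $(x_{j_i},x_{j_{i+1}})$ (oriented along the traversal) and $C_-=E(C)\setminus C_+$; the associated binomial is $t_C=\prod_{t_i\in C_+}t_i-\prod_{t_i\in C_-}t_i\in P_D$ (empty products equal $1$). Traversing $C$ in the opposite direction replaces $t_C$ by $-t_C$; both are binomials associated to $C$. Binomials are nonzero polynomials of the form $t^\alpha-t^\beta$. A binomial $t^\alpha-t^\beta\in P_D$ is primitive if there is no other binomial $t^{\alpha'}-t^{\beta'}\in P_D$ such that $t^{\alpha'}$ divides $t^\alpha$ and $t^{\beta'}$ divides $t^\beta$. *)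

(* Defs.v *)
From HB Require Import structures.
From mathcomp Require Import all_boot all_order all_algebra.
From mathcomp Require Import boolp.
From mathcomp Require Import mpoly.

Set Implicit Arguments.
Unset Strict Implicit.
Unset Printing Implicit Defensive.

Import GRing.Theory.
Local Open Scope ring_scope.

(* The Laurent polynomial ring k[x_1^{+-1}, ..., x_n^{+-1}] is built as the     *)
(* subring of the field of rational functions k(x_1, ..., x_n) formed by the  *)
(* fractions p / x^m whose denominator is a monomial.                         *)
Section Laurent.
Variables (k : fieldType) (n : nat).

Local Notation ratfun := {fraction {mpoly k[n]}}.
Local Notation to_ratfun := (@FracField.tofrac {mpoly k[n]}).

Definition is_laurent : {pred ratfun} := fun f =>
  `[< exists (p : {mpoly k[n]}) (m : 'X_{1..n}),
        f = to_ratfun p / to_ratfun 'X_[m] >].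

Lemma is_laurentP f :
  reflect (exists (p : {mpoly k[n]}) (m : 'X_{1..n}),
             f = to_ratfun p / to_ratfun 'X_[m])
          (f \in is_laurent).
Proof. exact: asboolP. Qed.

Lemma to_ratfun_mon_neq0 (m : 'X_{1..n}) : to_ratfun 'X_[m] != 0.
Proof. by rewrite tofrac_eq0 -msupp_eq0 msuppX. Qed.

Lemma is_laurent_poly p : to_ratfun p \in is_laurent.
Proof.
by apply/is_laurentP; exists p, 0%MM; rewrite mpolyX0 rmorph1 divr1.
Qed.

Lemma is_laurent_mon_inv (m : 'X_{1..n}) :
  (to_ratfun 'X_[m])^-1 \in is_laurent.
Proof. by apply/is_laurentP; exists 1, m; rewrite rmorph1 mul1r. Qed.

Fact is_laurent_subring : subring_closed is_laurent.
Proof.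
split=> [|u v /is_laurentP[p [m ->]] /is_laurentP[r [l ->]]
         |u v /is_laurentP[p [m ->]] /is_laurentP[r [l ->]]].
- by rewrite -(rmorph1 to_ratfun) is_laurent_poly.
- apply/is_laurentP; exists (p * 'X_[l] - r * 'X_[m]), (m + l)%MM.
  rewrite mpolyXD rmorphB !rmorphM -!mulNr.
  by rewrite addf_div ?to_ratfun_mon_neq0.
- apply/is_laurentP; exists (p * r), (m + l)%MM.
  by rewrite mpolyXD !rmorphM mulf_div.
Qed.

HB.instance Definition _ :=
  GRing.isSubringClosed.Build ratfun is_laurent is_laurent_subring.

Record laurent : predArgType :=
  Laurent { laurent_val :> ratfun; _ : laurent_val \in is_laurent }.

HB.instance Definition _ := [isSub for laurent_val].
HB.instance Definition _ := [Choice of laurent by <:].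
HB.instance Definition _ := [SubChoice_isSubComNzRing of laurent by <:].

Definition laurentC (c : k) : laurent := Laurent (is_laurent_poly c%:MP).

Fact laurentC_zmod : zmod_morphism laurentC.
Proof. by move=> a b; apply: val_inj; rewrite /= !rmorphB. Qed.

Fact laurentC_monoid : monoid_morphism laurentC.
Proof.
by split=> [|a b]; apply: val_inj; rewrite /= ?rmorph1 // !rmorphM.
Qed.

HB.instance Definition _ :=
  GRing.isZmodMorphism.Build k laurent laurentC laurentC_zmod.
HB.instance Definition _ :=
  GRing.isMonoidMorphism.Build k laurent laurentC laurentC_monoid.

Definition laurentX (i : 'I_n) : laurent := Laurent (is_laurent_poly 'X_i).
Definition laurentXV (i : 'I_n) : laurent :=
  Laurent (is_laurent_mon_inv U_(i)).

Lemma laurentXVK i : laurentX i * laurentXV i = 1.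
Proof. by apply: val_inj; rewrite /= divff ?to_ratfun_mon_neq0. Qed.

End Laurent.

(* [t] enumerates, without repetition, the edges of the graph [adj], each one *)
(* given a direction: [t l = (x, y)] is the edge from [x] to [y].             *)
Definition orientation n q (adj : rel 'I_n) (t : 'I_q -> 'I_n * 'I_n) : Prop :=
  (forall l, adj (t l).1 (t l).2) /\
  (forall x y, adj x y -> exists! l, t l = (x, y) \/ t l = (y, x)).

Definition toric_map (k : fieldType) n q (t : 'I_q -> 'I_n * 'I_n)
    (f : {mpoly k[q]}) : laurent k n :=
  mmap (@laurentC k n)
       (fun l => laurentX k (t l).2 * laurentXV k (t l).1) f.

Definition toric_ideal (k : fieldType) n q (t : 'I_q -> 'I_n * 'I_n) :
  {pred {mpoly k[q]}} := fun f => toric_map t f == 0.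

Arguments toric_ideal k {n q} t.

Definition mpoly_dvd (k : fieldType) q (f g : {mpoly k[q]}) : Prop :=
  exists h, g = f * h.

(* The pair (a, b) is determined by a nonzero binomial X^a - X^b, except that *)
(* in characteristic 2 it is determined only up to order; the minimality      *)
(* clause is invariant under this exchange.                                   *)
Definition primitive_binomial (k : fieldType) q (P : {pred {mpoly k[q]}})
    (f : {mpoly k[q]}) : Prop :=
  exists a b : 'X_{1..q},
    [/\ f = 'X_[a] - 'X_[b], f != 0, f \in P
      & forall a' b' : 'X_{1..q},
          'X_[a'] - 'X_[b'] != 0 :> {mpoly k[q]} ->
          'X_[a'] - 'X_[b'] \in P ->
          mpoly_dvd 'X_[k, a'] 'X_[a] -> mpoly_dvd 'X_[k, b'] 'X_[b] ->
          'X_[a'] - 'X_[b'] = f].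

(* The vertices x_{j_1}, ..., x_{j_m} of the cycle, without the repetition of *)
(* x_{j_1} at the end; [next c x] is the successor of [x] in the traversal.   *)
Definition graph_cycle n (adj : rel 'I_n) (c : seq 'I_n) : Prop :=
  (2 < size c)%N /\ ucycle adj c.

Section CycleBinomial.
Variables (n q : nat) (t : 'I_q -> 'I_n * 'I_n) (c : seq 'I_n).

Definition cycle_edges : {set 'I_q} :=
  [set l | [exists x in c, (t l == (x, next c x)) || (t l == (next c x, x))]].

Definition cycle_pos : {set 'I_q} :=
  [set l in cycle_edges | [exists x in c, t l == (x, next c x)]].

Definition cycle_neg : {set 'I_q} := cycle_edges :\: cycle_pos.

Definition cycle_binomial (k : fieldType) : {mpoly k[q]} :=
  \prod_(l in cycle_pos) 'X_l - \prod_(l in cycle_neg) 'X_l.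

End CycleBinomial.

(* Main.v *)
(** [X^a - X^b] lies in the toric ideal iff the integer edge function [a - b] is
    a circulation: at each vertex the inflow equals the outflow.  Where [a - b]
    is nonzero, direct the edge so that it is positive; by conservation a walk
    along directed edges never gets stuck, so it closes up into a cycle [C] whose
    binomial has both terms dividing those of [X^a - X^b].  Conversely a
    circulation supported on a cycle is constant along it, so nothing nonzero
    lies strictly below [t_C]. *)
Require Import Defs.
From mathcomp Require Import all_boot all_order all_algebra.
From mathcomp Require Import mpoly.

Set Implicit Arguments.
Unset Strict Implicit.
Unset Printing Implicit Defensive.

Local Open Scope ring_scope.

Import GRing.Theory.

(** * Monomials and divisibility *)

Section Monomials.
Variables (n : nat) (k : fieldType).

Lemma mpolyX_sub_eq0 (a b : 'X_{1..n}) :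
  ('X_[a] - 'X_[b] == 0 :> {mpoly k[n]}) = (a == b).
Proof.
rewrite subr_eq0; apply/eqP/eqP => [/(congr1 (mcoeff b))|-> //].
rewrite !mcoeffX eqxx; case: eqP => // _ /eqP.
by rewrite eq_sym oner_eq0.
Qed.

Lemma mpolyX_dvdP (a b : 'X_{1..n}) :
  mpoly_dvd ('X_[a] : {mpoly k[n]}) 'X_[b] <-> (a <= b)%MM.
Proof.
split=> [[h Eh]|le_ab].
  (* The support of a multiple of ['X_[a]] consists of exponents shifted by [a]. *)
  have : b \in msupp ('X_[b] : {mpoly k[n]}) by rewrite msuppX mem_head.
  rewrite Eh mulrC (perm_mem (msuppMX h a)) => /mapP[m _ ->].
  by rewrite lem_addr.
by exists 'X_[b - a]; rewrite mulrC -mpolyXD submK.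
Qed.

Lemma mpolyX_sum (I : Type) (r : seq I) (P : pred I) (F : I -> 'X_{1..n}) :
  'X_[(\sum_(i <- r | P i) F i)%MM] =
  \prod_(i <- r | P i) 'X_[F i] :> {mpoly k[n]}.
Proof. exact: (big_morph _ (@mpolyXD n k) (mpolyX0 n k)). Qed.

Lemma mnm_neq_ex (a b : 'X_{1..n}) : a != b -> exists l, a l != b l.
Proof.
move=> ab_neq; apply/existsP; rewrite -negb_forall.
by apply: contra ab_neq => /forallP ab; apply/eqP/mnmP=> l; apply/eqP.
Qed.

Definition mnm_of_set (A : {set 'I_n}) : 'X_{1..n} :=
  [multinom (l \in A : nat) | l < n].

Lemma mpolyX_mnm_of_set (A : {set 'I_n}) :
  \prod_(l in A) 'X_l = 'X_[mnm_of_set A] :> {mpoly k[n]}.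
Proof.
have -> : mnm_of_set A = (\sum_(l in A) U_(l))%MM.
  apply/mnmP=> l; rewrite mnmE mnm_sumE.
  case: (boolP (l \in A)) => lA.
    rewrite (bigD1 l) //= mnm1E eqxx big1 // => i /andP[_ /negPf il].
    by rewrite mnm1E il.
  rewrite big1 // => i iA; rewrite mnm1E; case: eqP => // il.
  by rewrite -il iA in lA.
by rewrite mpolyX_sum.
Qed.

End Monomials.

(** * Membership in the toric ideal as conservation of flow *)

Section Flow.
Variables (n q : nat) (t : 'I_q -> 'I_n * 'I_n).

(* Inflow at [v] of the circulation [a - b], up to moving the negative terms
   to the other side: conservation at [v] reads [flow a b v = flow b a v]. *)
Definition flow (a b : 'X_{1..q}) (v : 'I_n) : nat :=
  (\sum_l (a l * ((t l).2 == v) + b l * ((t l).1 == v)))%N.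

Definition balanced (a b : 'X_{1..q}) : Prop := flow a b =1 flow b a.

(** Exponent of the numerator of the image of ['X_[a]] times the denominator of that of ['X_[b]]. *)
Let flow_mnm (a b : 'X_{1..q}) : 'X_{1..n} :=
  (\sum_l (U_((t l).2) *+ a l + U_((t l).1) *+ b l))%MM.

Let flow_mnmE a b v : flow_mnm a b v = flow a b v.
Proof.
rewrite mnm_sumE; apply: eq_bigr => l _.
by rewrite mnmDE !mulmnE !mnm1E ![(_ * _ l)%N]mulnC.
Qed.

Lemma toric_map_mpolyX (k : fieldType) (a : 'X_{1..q}) :
  laurent_val (toric_map t 'X_[k, a]) =
  FracField.tofrac 'X_[(\sum_l (U_((t l).2) *+ a l))%MM] /
  FracField.tofrac 'X_[(\sum_l (U_((t l).1) *+ a l))%MM].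
Proof.
rewrite /toric_map mmapX /mmap1 !mpolyX_sum !rmorph_prod /= -prodf_div.
rewrite -[laurent_val _]/(val _) rmorph_prod /=; apply: eq_bigr => l _.
rewrite -[laurent_val _]/(val _).
by rewrite rmorphXn rmorphM /= expr_div_n -!mpolyXn !rmorphXn.
Qed.

(** Both monomials map to quotients of monomials. Cross-multiplying turns equality of the images
    into equality of two monomials in the vertices, whose exponents at [v] are the two flows. *)
Lemma toric_ideal_binomial (k : fieldType) (a b : 'X_{1..q}) :
  ('X_[a] - 'X_[b] \in toric_ideal k t) <-> balanced a b.
Proof.
have -> : ('X_[a] - 'X_[b] \in toric_ideal k t) =
          (flow_mnm a b == flow_mnm b a).
  rewrite -[LHS]/(toric_map t ('X_[a] - 'X_[b]) == 0).
  rewrite -[toric_map t _]/(mmap _ _ _) mmapB subr_eq0 -(inj_eq val_inj).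
  rewrite -!/(toric_map t _) /= !toric_map_mpolyX.
  rewrite eqr_div ?to_ratfun_mon_neq0 //.
  rewrite -!rmorphM tofrac_eq -!mpolyXD -!big_split /=.
  by rewrite -subr_eq0 mpolyX_sub_eq0.
split=> [/eqP E v|E]; first by rewrite -!flow_mnmE E.
by apply/eqP/mnmP=> v; rewrite !flow_mnmE.
Qed.

End Flow.

(** * Edges of an oriented simple graph *)

Section Walks.
Variables (n q : nat) (adj : rel 'I_n) (t : 'I_q -> 'I_n * 'I_n).
Hypotheses (adj_sym : ssrbool.symmetric adj).
Hypotheses (adj_irr : ssrbool.irreflexive adj) (tO : orientation adj t).

Definition link (x y : 'I_n) (l : 'I_q) : bool :=
  (t l == (x, y)) || (t l == (y, x)).

Lemma linkC x y l : link x y l = link y x l.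
Proof. exact: orbC. Qed.

Lemma link_adj x y l : link x y l -> adj x y.
Proof.
case/orP => /eqP tl; move: (tO.1 l); rewrite tl //=.
by rewrite adj_sym.
Qed.

Lemma link_inj x y l l' : link x y l -> link x y l' -> l = l'.
Proof.
move=> xyl xyl'; have [l0 [_ l0_uniq]] := tO.2 _ _ (link_adj xyl).
have link_l0 m : link x y m -> l0 = m.
  by move=> xym; apply: l0_uniq; case/orP: xym => /eqP; [left | right].
by rewrite -(link_l0 _ xyl) (link_l0 _ xyl').
Qed.

Lemma adj_link x y : adj x y -> exists l, link x y l.
Proof.
by move/tO.2=> [l [xyl _]]; exists l; apply/orP; case: xyl => ->; [left|right].
Qed.

Lemma adj_neq x y : adj x y -> x != y.
Proof. by apply: contraTneq => ->; rewrite adj_irr. Qed.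

(** * Extracting a cycle from a nonzero circulation *)

Section Conformal.
Variables (a b : 'X_{1..q}).
Hypotheses (ab_bal : balanced t a b) (ab_neq : a != b).

(* The edges along which [a - b] is nonzero, directed so that it is positive. *)
Definition conformal_step : rel 'I_n := fun x y =>
  [exists l, (t l == (x, y)) && (b l < a l)%N
          || (t l == (y, x)) && (a l < b l)%N].

(** The edge joining [x] and [y] is unique, so the witness of the step must be [l]. *)
Lemma conformal_stepP x y l : link x y l ->
  conformal_step x y ->
  t l = (x, y) /\ (b l < a l)%N \/ t l = (y, x) /\ (a l < b l)%N.
Proof.
move=> xyl /existsP[l' xyl'].
have <- : l' = l.
  by apply: link_inj xyl; case/orP: xyl' => /andP[tl _]; rewrite /link tl ?orbT.
by case/orP: xyl' => /andP[/eqP tl lt]; [left | right].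
Qed.

Lemma conformal_step_adj x y : conformal_step x y -> adj x y.
Proof.
case/existsP=> l xyl; apply: (@link_adj x y l).
by case/orP: xyl => /andP[tl _]; rewrite /link tl ?orbT.
Qed.

(** Both steps would use the same edge and, loops being excluded, demand opposite signs of [a - b]
    on it. This rules out closed walks of length two. *)
Lemma conformal_step_asym x y :
  conformal_step x y -> conformal_step y x -> False.
Proof.
move=> xy yx; have adj_xy := conformal_step_adj xy.
have [l xyl] := adj_link adj_xy; have yxl := xyl; rewrite linkC in yxl.
have := adj_neq adj_xy; apply/negP; rewrite negbK; apply/eqP.
case: (conformal_stepP xyl xy) (conformal_stepP yxl yx) => [] [tl lt] [] [tl' lt'].
- by move: tl'; rewrite tl => -[].
- by have := ltn_trans lt lt'; rewrite ltnn.
- by have := ltn_trans lt lt'; rewrite ltnn.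
- by move: tl'; rewrite tl => -[].
Qed.

Lemma conformal_step_exists : exists x y, conformal_step x y.
Proof.
have [l ab_l] : exists l, a l != b l by exact: mnm_neq_ex.
case: (ltngtP (a l) (b l)) (negPf ab_l) => // lt _.
  exists (t l).2, (t l).1; apply/existsP; exists l.
  by rewrite lt andbT -surjective_pairing eqxx orbT.
exists (t l).1, (t l).2; apply/existsP; exists l.
by rewrite lt andbT -surjective_pairing eqxx.
Qed.

(* If no step left [v], every edge would contribute at least as much to
   [flow t a b v] as to [flow t b a v], and the incoming step strictly more. *)
Lemma conformal_step_continue x v :
  conformal_step x v -> exists y, conformal_step v y.
Proof.
move=> xv; apply/existsP; apply: contraT; rewrite negb_exists => /forallP no_out.
have no_head l : (t l).2 = v -> (b l <= a l)%N.
  move=> tl; rewrite leqNgt; apply: contra (no_out (t l).1) => lt.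
  apply/existsP; exists l; rewrite lt andbT -tl.
  by rewrite -surjective_pairing eqxx orbT.
have no_tail l : (t l).1 = v -> (a l <= b l)%N.
  move=> tl; rewrite leqNgt; apply: contra (no_out (t l).2) => lt.
  apply/existsP; exists l; rewrite lt andbT -tl.
  by rewrite -surjective_pairing eqxx.
have [l0 xvl0] := adj_link (conformal_step_adj xv).
have /negPf neq := adj_neq (conformal_step_adj xv).
have := ab_bal v; rewrite /flow (bigD1 l0) //= [RHS](bigD1 l0) //=.
move/eqP; rewrite eqn_leq => /andP[+ _]; rewrite leqNgt => /negP[].
rewrite -addSn; apply: leq_add.
  by case: (conformal_stepP xvl0 xv) => -[-> /= lt];
     rewrite eqxx neq !muln1 !muln0 ?addn0.
apply: leq_sum => l _.
case: (eqVneq (t l).2 v) => [/no_head|] le2;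
  case: (eqVneq (t l).1 v) => [/no_tail|] le1;
  by rewrite ?muln1 ?muln0 ?addn0 ?add0n // addnC.
Qed.

Let can_step x : bool := [exists y, conformal_step x y].
(** The value [x] at a dead end is only a default: by [conformal_step_continue], the iterates of
    [succ] from a vertex with a step out never reach one. *)
Let succ x : 'I_n := odflt x [pick y | conformal_step x y].

Let succ_step x : can_step x -> conformal_step x (succ x).
Proof.
rewrite /succ; case: pickP => //= no_step /existsP[y].
by rewrite no_step.
Qed.

Let can_step_succ x : can_step x -> can_step (succ x).
Proof. by move/succ_step/conformal_step_continue=> H; apply/existsP. Qed.

Lemma conformal_cycle :
  exists2 c, graph_cycle adj c & {in c, forall x, conformal_step x (next c x)}.
Proof.
have [x0 x0_out] : exists x, can_step x.
  by have [x [y xy]] := conformal_step_exists; exists x; apply/existsP; exists y.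
(* A point whose forward orbit is smallest is periodic. *)
have [y y_out y_min] := arg_minnP (order succ) x0_out.
have y_per : fcycle succ (orbit succ y).
  (* Periodicity amounts to [order succ (succ y) = order succ y]. Minimality gives one inequality;
     the other holds because the orbit of [succ y] lies in that of [y]. *)
  apply/(@orbitPcycle _ succ y 0 1); apply/eqP; rewrite eqn_leq y_min ?can_step_succ //.
  rewrite andbT; apply: subset_leq_card; apply/subsetP=> z; rewrite !inE.
  exact/connect_trans/fconnect1.
have orbit_out z : z \in orbit succ y -> can_step z.
  rewrite -fconnect_orbit => /iter_findex <-.
  by elim: (findex _ _ _) => //= i; exact: can_step_succ.
have orbit_next z : z \in orbit succ y -> conformal_step z (next (orbit succ y) z).
  move=> yz; rewrite -(eqP (next_cycle y_per yz)); exact/succ_step/orbit_out.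
exists (orbit succ y) => //; split; last first.
  apply/andP; split; last exact: orbit_uniq.
  apply: (sub_in_cycle (P := mem (orbit succ y)) _ _ y_per); last exact/allP.
  move=> u v yu _ /= /eqP <-.
  exact: conformal_step_adj (succ_step (orbit_out _ yu)).
have y_iter := (@orbitPcycle _ succ y 0 4).1 y_per.
have y_step := succ_step y_out; have fy_step := succ_step (can_step_succ y_out).
rewrite size_orbit; move: (order_gt0 succ y) y_iter.
(* Period one would be a loop, and period two a pair of opposite steps. *)
case: (order succ y) => [|[|[|m]]] //= _ Ey.
  by have := adj_neq (conformal_step_adj y_step); rewrite Ey eqxx.
by case: (conformal_step_asym y_step); rewrite -{2}Ey.
Qed.
End Conformal.

(** * Positive and negative edges of a fixed cycle *)

Section Cycle.
Variable c : seq 'I_n.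
Hypothesis c_cycle : graph_cycle adj c.

Let c_uniq : uniq c.
Proof. by case: c_cycle => _ /andP[]. Qed.

Let link_next_adj x : x \in c -> adj x (next c x).
Proof. by case: c_cycle => _ /andP[adj_c _]; apply: next_cycle. Qed.

(** Otherwise iterating [next c] from [x] would reach only two vertices, against the length of the
    cycle. *)
Lemma next_next_neq x : x \in c -> next c (next c x) != x.
Proof.
move=> xc; apply/eqP => nnx.
have sub : {subset c <= [:: x; next c x]}.
  move=> y; rewrite -(fconnect_cycle (cycle_next c_uniq) xc) => /iter_findex <-.
  elim: (findex _ _ _) => [|i]; rewrite !inE ?eqxx //= => /orP[] /eqP ->.
    by rewrite eqxx orbT.
  by rewrite nnx eqxx.
by have := uniq_leq_size c_uniq sub; rewrite leqNgt c_cycle.1.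
Qed.

Lemma in_cycle_pos l :
  (l \in cycle_pos t c) = ((t l).1 \in c) && ((t l).2 == next c (t l).1).
Proof.
rewrite !inE; apply/andP/andP => [[_ /existsP[x /andP[xc /eqP ->]]] //|].
move=> [tlc /eqP tl].
by split; apply/existsP; exists (t l).1; rewrite tlc -tl -surjective_pairing eqxx.
Qed.

(** A reversed edge is not also traversed forwards, since that would make the cycle return after two
    steps. *)
Lemma in_cycle_neg l :
  (l \in cycle_neg t c) = ((t l).2 \in c) && ((t l).1 == next c (t l).2).
Proof.
rewrite inE in_cycle_pos inE; apply/andP/andP => [[Npos]|[tlc /eqP tl]].
  case/existsP=> x /andP[xc /orP[] /eqP tl]; last by rewrite tl.
  by move: Npos; rewrite tl /= xc eqxx.
split; first by apply/nandP; right; rewrite tl eq_sym next_next_neq.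
by apply/existsP; exists (t l).2; rewrite tlc -tl -surjective_pairing eqxx orbT.
Qed.

Lemma cycle_edge_pos_neg x l : x \in c -> link x (next c x) l ->
  (l \in cycle_pos t c) = (l \notin cycle_neg t c).
Proof.
move=> xc xl; rewrite in_setD negb_and negbK.
suff -> : l \in cycle_edges t c by rewrite orbF.
by rewrite inE; apply/existsP; exists x; rewrite xc.
Qed.

(** Turns the incidence indicators in [flow] into the test [l' == l], so that sums over edges
    collapse to one term. It rests on injectivity of [next c] and uniqueness of the edge between two
    vertices. *)
Lemma cycle_pos_edge x l l' : x \in c -> link x (next c x) l ->
    l' \in cycle_pos t c ->
  ((t l').1 == x) = (l' == l) /\ ((t l').2 == next c x) = (l' == l).
Proof.
rewrite in_cycle_pos => xc xl /andP[tl'c /eqP tl'].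
rewrite tl' (can_eq (prev_next c_uniq)).
suff -> : ((t l').1 == x) = (l' == l) by [].
apply/eqP/eqP => [tx|ll'].
  by apply: link_inj xl; rewrite /link -tx -tl' -surjective_pairing eqxx.
rewrite -ll' in xl; case/orP: xl => /eqP txl; first by rewrite txl.
by move: tl'; rewrite txl /= => /esym/eqP; rewrite (negPf (next_next_neq xc)).
Qed.

Lemma cycle_neg_edge x l l' : x \in c -> link x (next c x) l ->
    l' \in cycle_neg t c ->
  ((t l').2 == x) = (l' == l) /\ ((t l').1 == next c x) = (l' == l).
Proof.
rewrite in_cycle_neg => xc xl /andP[tl'c /eqP tl'].
rewrite tl' (can_eq (prev_next c_uniq)).
suff -> : ((t l').2 == x) = (l' == l) by [].
apply/eqP/eqP => [tx|ll'].
  by apply: link_inj xl; rewrite /link -tx -tl' -surjective_pairing eqxx orbT.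
rewrite -ll' in xl; case/orP: xl => /eqP txl; last by rewrite txl.
by move: tl'; rewrite txl /= => /esym/eqP; rewrite (negPf (next_next_neq xc)).
Qed.

(** * Circulations supported on a cycle *)

Section Supported.
Variables (a b : 'X_{1..q}).
Hypotheses (a_pos : (a <= mnm_of_set (cycle_pos t c))%MM).
Hypotheses (b_neg : (b <= mnm_of_set (cycle_neg t c))%MM).

Let a_supp l : l \notin cycle_pos t c -> a l = 0%N.
Proof.
by move=> lN; have /mnm_lepP/(_ l) := a_pos; rewrite mnmE (negPf lN) leqn0 => /eqP.
Qed.

Let b_supp l : l \notin cycle_neg t c -> b l = 0%N.
Proof.
by move=> lN; have /mnm_lepP/(_ l) := b_neg; rewrite mnmE (negPf lN) leqn0 => /eqP.
Qed.

Let sum_at l : (\sum_l' (a l' * (l' == l) + b l' * (l' == l)))%N = (a l + b l)%N.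
Proof.
rewrite (bigD1 l) //= eqxx !muln1 big1 ?addn0 // => l' /negPf ->.
by rewrite !muln0.
Qed.

(** At [next c x], positive edges count through their head and negative ones through their tail;
    either way only [l] can contribute. *)
Lemma flow_into_cycle x l : x \in c -> link x (next c x) l ->
  flow t a b (next c x) = (a l + b l)%N.
Proof.
move=> xc xl; rewrite -sum_at; apply: eq_bigr => l' _; congr addn.
  by case: (boolP (l' \in cycle_pos t c)) =>
    [/(cycle_pos_edge xc xl)[_ ->]|/a_supp ->].
by case: (boolP (l' \in cycle_neg t c)) =>
  [/(cycle_neg_edge xc xl)[_ ->]|/b_supp ->].
Qed.

Lemma flow_out_of_cycle x l : x \in c -> link x (next c x) l ->
  flow t b a x = (a l + b l)%N.
Proof.
move=> xc xl; rewrite -sum_at; apply: eq_bigr => l' _; rewrite addnC; congr addn.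
  by case: (boolP (l' \in cycle_pos t c)) =>
    [/(cycle_pos_edge xc xl)[-> _]|/a_supp ->].
by case: (boolP (l' \in cycle_neg t c)) =>
  [/(cycle_neg_edge xc xl)[-> _]|/b_supp ->].
Qed.

Lemma flow_off_cycle v : v \notin c -> flow t a b v = 0%N /\ flow t b a v = 0%N.
Proof.
move=> vNc.
have a0 l : (a l * ((t l).1 == v) = 0 /\ a l * ((t l).2 == v) = 0)%N.
  case: (boolP (l \in cycle_pos t c)) => [|/a_supp -> //].
  rewrite in_cycle_pos => /andP[tlc /eqP ->]; split.
    by case: eqP => [tv|]; rewrite ?muln0 //; rewrite tv (negPf vNc) in tlc.
  case: eqP => [tv|]; rewrite ?muln0 //.
  by rewrite -(mem_next c) tv (negPf vNc) in tlc.
have b0 l : (b l * ((t l).1 == v) = 0 /\ b l * ((t l).2 == v) = 0)%N.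
  case: (boolP (l \in cycle_neg t c)) => [|/b_supp -> //].
  rewrite in_cycle_neg => /andP[tlc /eqP ->]; split.
    case: eqP => [tv|]; rewrite ?muln0 //.
    by rewrite -(mem_next c) tv (negPf vNc) in tlc.
  by case: eqP => [tv|]; rewrite ?muln0 //; rewrite tv (negPf vNc) in tlc.
by split; apply: big1 => l _; rewrite ?(a0 l).1 ?(a0 l).2 ?(b0 l).1 ?(b0 l).2.
Qed.

(* Balance at a vertex of the cycle forces the two cycle edges meeting there
   to have the same multiplicity [a l + b l], which is at most one. *)
Lemma balanced_supported : balanced t a b -> a != b ->
  a = mnm_of_set (cycle_pos t c) /\ b = mnm_of_set (cycle_neg t c).
Proof.
move=> ab_bal ab_neq.
have m_const x y l l' : x \in c -> y \in c ->
    link x (next c x) l -> link y (next c y) l' -> (a l + b l = a l' + b l')%N.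
  move=> xc yc xl yl'.
  rewrite -(flow_out_of_cycle xc xl) -(flow_out_of_cycle yc yl') {l l' xl yl'}.
  (* Walk from [x] to [y] by [next c]: the flow out along an edge is the flow into its end, which
     balance equates with the flow out of that end. *)
  move: yc; rewrite -(fconnect_cycle (cycle_next c_uniq) xc) => /iter_findex <-.
  elim: (findex _ _ _) => //= i ->.
  have ic : iter i (next c) x \in c by elim: i => //= i; rewrite mem_next.
  have [l il] := adj_link (link_next_adj ic).
  by rewrite (flow_out_of_cycle ic il) -(flow_into_cycle ic il) ab_bal.
have edge_of l : (l \in cycle_pos t c) || (l \in cycle_neg t c) ->
    exists2 x, x \in c & link x (next c x) l.
  rewrite in_cycle_pos in_cycle_neg => /orP[] /andP[tlc /eqP tl].
    by exists (t l).1; rewrite // /link -tl -surjective_pairing eqxx.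
  by exists (t l).2; rewrite // /link -tl -surjective_pairing eqxx orbT.
have [l0 ab_l0] : exists l, a l != b l by exact: mnm_neq_ex.
have [x0 x0c x0l0] : exists2 x, x \in c & link x (next c x) l0.
  apply: edge_of; apply: contraR ab_l0; rewrite negb_or => /andP[/a_supp -> /b_supp ->].
  by rewrite eqxx.
(* The multiplicity is nonzero at [l0], where [a] and [b] differ, hence by constancy on the whole
   cycle. *)
have m_pos l : (l \in cycle_pos t c) || (l \in cycle_neg t c) -> (0 < a l + b l)%N.
  move=> /edge_of[x xc xl]; rewrite (m_const x x0 l l0) // lt0n addn_eq0.
  by apply: contra ab_l0 => /andP[/eqP -> /eqP ->].
split; apply/mnmP=> l; rewrite mnmE.
  case: (boolP (l \in cycle_pos t c)) => [lpos|/a_supp -> //].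
  have := m_pos l; rewrite lpos => /(_ isT).
  have /edge_of[x xc xl] : (l \in cycle_pos t c) || (l \in cycle_neg t c).
    by rewrite lpos.
  rewrite b_supp -?(cycle_edge_pos_neg xc xl) // addn0 => al.
  apply/eqP; rewrite eqn_leq al andbT.
  by have /mnm_lepP/(_ l) := a_pos; rewrite mnmE lpos.
case: (boolP (l \in cycle_neg t c)) => [lneg|/b_supp -> //].
have := m_pos l; rewrite lneg orbT => /(_ isT).
have /edge_of[x xc xl] : (l \in cycle_pos t c) || (l \in cycle_neg t c).
  by rewrite lneg orbT.
rewrite a_supp ?(cycle_edge_pos_neg xc xl) ?lneg // add0n => bl.
apply/eqP; rewrite eqn_leq bl andbT.
by have /mnm_lepP/(_ l) := b_neg; rewrite mnmE lneg.
Qed.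

End Supported.

(** Every cycle edge lies in exactly one of the two sets, so both flows equal 1 at a vertex of the
    cycle; elsewhere both vanish. *)
Lemma cycle_balanced :
  balanced t (mnm_of_set (cycle_pos t c)) (mnm_of_set (cycle_neg t c)).
Proof.
move=> v; have [vc|vNc] := boolP (v \in c); last first.
  by have [-> ->] := flow_off_cycle (lepm_refl _) (lepm_refl _) vNc.
have pvc : prev c v \in c by rewrite mem_prev.
have [l vl] := adj_link (link_next_adj vc).
have [l' pvl'] := adj_link (link_next_adj pvc).
rewrite (flow_out_of_cycle (lepm_refl _) (lepm_refl _) vc vl).
rewrite -[v in LHS](next_prev c_uniq).
rewrite (flow_into_cycle (lepm_refl _) (lepm_refl _) pvc pvl') !mnmE.
rewrite (cycle_edge_pos_neg vc vl) (cycle_edge_pos_neg pvc pvl').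
by case: (_ \in _); case: (_ \in _).
Qed.

Lemma cycle_mnm_neq : mnm_of_set (cycle_pos t c) != mnm_of_set (cycle_neg t c).
Proof.
have [x xc] : exists x, x \in c.
  by case: c c_cycle.1 => [|x s _] //; exists x; rewrite mem_head.
have [l xl] := adj_link (link_next_adj xc).
apply/eqP => /mnmP/(_ l); rewrite !mnmE (cycle_edge_pos_neg xc xl).
by case: (_ \in _).
Qed.

End Cycle.

(** The exponents of the cycle are at most 1, so strict inequality between [a l] and [b l] in the
    direction of traversal is enough. *)
Lemma conformal_cycle_le (a b : 'X_{1..q}) c : graph_cycle adj c ->
    {in c, forall x, conformal_step a b x (next c x)} ->
  (mnm_of_set (cycle_pos t c) <= a)%MM /\ (mnm_of_set (cycle_neg t c) <= b)%MM.
Proof.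
move=> c_cycle c_step; split; apply/mnm_lepP => l; rewrite mnmE.
  have [|//] := boolP (l \in _).
  rewrite in_cycle_pos => /andP[tlc /eqP tl].
  have tl_link : link (t l).1 (next c (t l).1) l.
    by rewrite /link -tl -surjective_pairing eqxx.
  have := adj_neq (link_adj tl_link).
  case: (conformal_stepP tl_link (c_step _ tlc)) => [] [tl' lt].
    by rewrite (leq_ltn_trans _ lt).
  (* The opposite direction would make the edge a loop. *)
  by rewrite {1}tl' eqxx.
have [|//] := boolP (l \in _).
rewrite (in_cycle_neg c_cycle) => /andP[tlc /eqP tl].
have tl_link : link (t l).2 (next c (t l).2) l.
  by rewrite /link -tl -surjective_pairing eqxx orbT.
have := adj_neq (link_adj tl_link).
case: (conformal_stepP tl_link (c_step _ tlc)) => [] [tl' lt].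
  by rewrite {1}tl' eqxx.
by rewrite (leq_ltn_trans _ lt).
Qed.

End Walks.

Theorem proposition2p8 (k : fieldType) (n q : nat) (adj : rel 'I_n)
    (adj_sym : ssrbool.symmetric adj) (adj_irr : ssrbool.irreflexive adj)
    (t : 'I_q -> 'I_n * 'I_n) (tO : orientation adj t)
    (f : {mpoly k[q]}) :
  primitive_binomial (toric_ideal k t) f <->
  exists c : seq 'I_n, graph_cycle adj c /\ f = cycle_binomial t c k.
Proof.
split=> [[a [b [-> f_neq0 fP f_min]]]|[c [c_cycle ->]]].
  move: fP f_neq0; rewrite mpolyX_sub_eq0 => /toric_ideal_binomial ab_bal ab_neq.
  have [c c_cycle c_step] := conformal_cycle adj_sym adj_irr tO ab_bal ab_neq.
  have [le_a le_b] := conformal_cycle_le adj_sym adj_irr tO c_cycle c_step.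
  exists c; split=> //; rewrite /cycle_binomial !mpolyX_mnm_of_set.
  (* Minimality, applied to the exponents of the cycle, forces its binomial to be the given one. *)
  symmetry; apply: f_min; try exact/mpolyX_dvdP.
    by rewrite mpolyX_sub_eq0; apply: cycle_mnm_neq c_cycle.
  by apply/toric_ideal_binomial; apply: cycle_balanced c_cycle.
rewrite /cycle_binomial !mpolyX_mnm_of_set.
exists (mnm_of_set (cycle_pos t c)), (mnm_of_set (cycle_neg t c)); split=> //.
- by rewrite mpolyX_sub_eq0; apply: cycle_mnm_neq c_cycle.
- by apply/toric_ideal_binomial; apply: cycle_balanced c_cycle.
move=> a b; rewrite mpolyX_sub_eq0 => ab_neq /toric_ideal_binomial ab_bal.
move=> /mpolyX_dvdP le_a /mpolyX_dvdP le_b.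
by have [-> ->] := balanced_supported adj_sym tO c_cycle le_a le_b ab_bal ab_neq.
Qed.
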